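(* Let $\mathcal{X}$ be a set, let $\mathcal{H}\subseteq\{0,1\}^{\mathcal{X}}$ be a hypothesis class, and let $A$ be a learning rule. Assume there exist $k\in\mathbb{N}$ and $\gamma>0$ such that for every $\mathcal{H}$-realizable distribution $\mathcal{D}$, $$\mathbb{E}_{S\sim\mathcal{D}^k}[L_{\mathcal{D}}(A(S))]\le\tfrac12-\gamma,$$ and there exist $\mathcal{P}\in\Delta(\{0,1\}^{\mathcal{X}})$ and $b\ge0$ such that for every $\mathcal{H}$-realizable distribution $\mathcal{D}$, $$\mathbb{E}_{S\sim\mathcal{D}^k}[\mathsf{KL}(A(S)\,\|\,\mathcal{P})]\le b.$$ Then there exists an interpolating learning rule $A^\star$ that PAC learns $\mathcal{H}$ with logarithmic $\mathsf{KL}$-stability. More explicitly, there exist a prior distribution $\mathcal{P}^\star\in\Delta(\{0,1\}^{\mathcal{X}})$ and functions $b^\star$ and $\varepsilon^\star$ of $m$ that depend on $\gamma$ and $b$, with $b^\star(m)=O(\log m)$ and $\varepsilon^\star(m)=O\big(\sqrt{\log(m)/m}\big)$, such that for every $\mathcal{H}$-realizable distribution $\mathcal{D}$ and every $m\in\mathbb{N}$, $$\Pr_{S\sim\mathcal{D}^m}\big[\mathsf{KL}(A^\star(S)\,\|\,\mathcal{P}^\star)\le b^\star(m)\big]=1\quad\text{and}\quad\mathbb{E}_{S\sim\mathcal{D}^m}[L_{\mathcal{D}}(A^\star(S))]\le\varepsilon^\star(m).$$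
   Context: Measurability assumptions are implicit throughout. $\Delta(\Omega)$ is the set of probability distributions over $\Omega$. A learning rule is a function $A:(\mathcal{X}\times\{0,1\})^*\to\Delta(\{0,1\}^{\mathcal{X}})$ mapping a finite training sample to a distribution over hypotheses (no computability is required). Losses: for $S=((x_1,y_1),\dots,(x_m,y_m))$, $L_S(h)=\frac1m\sum_{i=1}^m\mathbf{1}[h(x_i)\ne y_i]$; for $\mathcal{D}\in\Delta(\mathcal{X}\times\{0,1\})$, $L_{\mathcal{D}}(h)=\Pr_{(x,y)\sim\mathcal{D}}[h(x)\ne y]$, and $L_{\mathcal{D}}(A(S))=\mathbb{E}_{h\sim A(S)}[L_{\mathcal{D}}(h)]$. A distribution $\mathcal{D}\in\Delta(\mathcal{X}\times\{0,1\})$ is $\mathcal{H}$-realizable if $\inf_{h\in\mathcal{H}}L_{\mathcal{D}}(h)=0$; a sample $S$ is $\mathcal{H}$-realizable if $L_S(h)=0$ for some $h\in\mathcal{H}$. A learning rule $A$ is interpolating if for every $\mathcal{H}$-realizable input sample $S$, $\Pr_{h\sim A(S)}[L_S(h)=0]=1$. $A$ PAC learns $\mathcal{H}$ if there is a function $\varepsilon$ with $\lim_{m\to\infty}\varepsilon(m)=0$ such that $\mathbb{E}_{S\sim\mathcal{D}^m}[L_{\mathcal{D}}(A(S))]\le\varepsilon(m)$ for all $\mathcal{H}$-realizable $\mathcal{D}$ and all $m\in\mathbb{N}$. $\mathsf{KL}(\mathcal{P}\|\mathcal{Q})=\mathbb{E}_{x\sim\mathcal{P}}[\log(\mathcal{P}(x)/\mathcal{Q}(x))]$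 is the Kullback–Leibler divergence. ''Logarithmic $\mathsf{KL}$-stability'' means exactly the explicit bound on $\mathsf{KL}(A^\star(S)\|\mathcal{P}^\star)$ stated in the claim. $O(\cdot)$ refers to $m\to\infty$. *)

(* Defs.v *)
From HB Require Import structures.
From mathcomp Require Import all_boot all_order all_algebra.
From mathcomp Require Import all_classical all_reals all_analysis.
From mathcomp Require Import measurable_realfun.

Set Implicit Arguments.
Unset Strict Implicit.
Unset Printing Implicit Defensive.

Import Order.TTheory GRing.Theory Num.Theory.
Import numFieldNormedType.Exports.

Local Open Scope classical_set_scope.
Local Open Scope ring_scope.
Local Open Scope ereal_scope.
Local Open Scope charge_scope.

(* Measurable structure on the hypotheses {0,1}^X.  For uncountable X no
   sigma-algebra on the whole of {0,1}^X makes (h, x) |-> h x jointly measurable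
   in the cases of interest, so the carrier is a measurable space of functions
   X -> bool (identified with its image under the injection [eval]) on which
   evaluation is jointly measurable and which, like {0,1}^X itself, is closed
   under the pointwise Boolean operations, these being measurable.  For
   countable discrete X, {0,1}^X with its product sigma-algebra is an
   instance. *)
Record hypothesis_space (dX : measure_display) (X : measurableType dX) :=
  HypothesisSpace {
    hyp_display : measure_display ;
    hyp :> measurableType hyp_display ;
    eval : hyp -> X -> bool ;
    eval_inj : injective eval ;
    measurable_eval :
      measurable_fun [set: (hyp * X)%type] (fun p => eval p.1 p.2) ;
    hyp_neg : hyp -> hyp ;
    eval_neg : forall h x, eval (hyp_neg h) x = ~~ eval h x ;
    measurable_hyp_neg : measurable_fun [set: hyp] hyp_neg ;
    hyp_and : hyp -> hyp -> hyp ;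
    eval_and : forall h1 h2 x, eval (hyp_and h1 h2) x = eval h1 x && eval h2 x ;
    measurable_hyp_and :
      measurable_fun [set: (hyp * hyp)%type] (fun p => hyp_and p.1 p.2)
  }.

Section iid.
Context (d : measure_display) (T : measurableType d) (R : realType).

Definition cons_pair (n : nat) (p : T * n.-tuple T) : n.+1.-tuple T :=
  [the n.+1.-tuple T of p.1 :: p.2].

Lemma measurable_cons_pair (n : nat) : measurable_fun setT (@cons_pair n).
Proof. exact: measurable_cons. Qed.

HB.instance Definition _ (n : nat) :=
  @isMeasurableFun.Build _ _ _ _ (@cons_pair n) (@measurable_cons_pair n).

(* The law D^m of m independent draws from D: D^0 is the point mass at the
   empty tuple and D^(n+1) is the image of the product D \x D^n under cons. *)
Fixpoint iid (D : probability T R) (m : nat) : probability (m.-tuple T) R :=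
  match m with
  | 0%N => \d_([tuple])
  | n.+1 => distribution (D \x iid D n) (@cons_pair n)
  end.

End iid.

(* The density is finite everywhere; the set where it is not positive, on which
   ln is 0 by convention, is P-null.  The negative part of the integrand always
   has a finite integral, so the integral is never of the form oo - oo. *)
Definition KL (d : measure_display) (T : measurableType d) (R : realType)
    (P Q : probability T R) : \bar R :=
  if `[< P `<< Q >] then
    \int[P]_x (ln (fine ('d (charge_of_finite_measure P) '/d Q x)))%:E
  else +oo.

Section learning.
Context (dX : measure_display) (X : measurableType dX) (R : realType).
Implicit Types (h : X -> bool) (H : set (X -> bool)).
Implicit Types (D : probability (X * bool)%type R).

(* For the empty sample the value is 0 / 0 = 0. *)
Definition emp_loss (S : seq (X * bool)) h : R :=
  ((\sum_(z <- S) (h z.1 != z.2)%:R) / (size S)%:R)%R.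

Definition loss D h : \bar R := D [set z | h z.1 != z.2].

Definition realizable_sample H (S : seq (X * bool)) : Prop :=
  exists2 h, H h & emp_loss S h = 0%R.

Definition realizable H D : Prop := ereal_inf [set loss D h | h in H] = 0.

Context (F : hypothesis_space X).

Record learning_rule := LearningRule {
  rule :> seq (X * bool) -> probability F R ;
  measurable_rule : forall (m : nat) (E : set F), measurable E ->
    measurable_fun [set: m.-tuple (X * bool)%type]
      (fun S : m.-tuple (X * bool)%type => rule S E)
}.

Implicit Type A : learning_rule.

Definition gibbs_loss D (Q : probability F R) : \bar R :=
  \int[Q]_g loss D (eval g).

Definition expected_loss D A (m : nat) : \bar R :=
  \int[iid D m]_S gibbs_loss D (A S).

Definition interpolating H A : Prop :=
  forall S, realizable_sample H S ->
    A S [set g | emp_loss S (eval g) = 0%R] = 1.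

Definition PAC_learns H A : Prop :=
  exists2 eps : nat -> R, eps @ \oo --> (0 : R)%R &
    forall D, realizable H D -> forall m, expected_loss D A m <= (eps m)%:E.

End learning.
Arguments learning_rule {dX X} R F.

(* Main.v *)
(* Averaging the Donsker-Varadhan inequality over the sample shows that for every
   realizable D a fixed fraction p of the prior P, depending only on gamma and b,
   consists of deterministic weak learners for D.  Run boosting with hypotheses
   drawn independently from P itself: with probability at least p^T every one of
   T = O(log m) draws is a weak learner for the current weights, and then the
   majority vote interpolates the sample.  Hence the mixture P* of the laws of
   the T-fold majority votes gives mass 1/poly(m) to the interpolants of every
   realizable sample of size m.  A*(S) is P* conditioned on interpolating S: its
   density with respect to P* is bounded by poly(m), which bounds the KL
   divergence by O(log m) and turns generalization into Occam's razor. *)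
Require Import Defs.
From mathcomp Require Import all_boot all_order all_algebra.
From mathcomp Require Import all_classical all_reals all_analysis.
From mathcomp Require Import measurable_realfun.
From HB Require Import structures.
From mathcomp Require Import zify ring lra.
Import Order.TTheory GRing.Theory Num.Theory.
Import numFieldNormedType.Exports.
Local Open Scope classical_set_scope.
Local Open Scope ring_scope.

(** * Lower and upper bounds on relative entropy *)

Section relative_entropy.
Context {d : measure_display} {T : measurableType d} {R : realType}.
Local Open Scope ereal_scope.
Local Open Scope charge_scope.

(** Positive and negative parts are compared separately, so [g] may have an infinite integral; it is
    applied with a log density and with [KL] as a function of the sample. *)
Lemma le_integral_integrablel (mu : {measure set T -> \bar R})
    (f g : T -> \bar R) : mu.-integrable setT f -> measurable_fun setT g ->
  (forall x, f x <= g x) -> \int[mu]_x f x <= \int[mu]_x g x.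
Proof.
move=> intf mg fg; rewrite integralE [leRHS]integralE.
have mf := measurable_int _ intf.
apply: leeB; apply: ge0_le_integral => //.
- exact: measurable_funepos.
- exact: measurable_funepos.
- by move=> x _; apply: (@funepos_le _ _ setT) => //; rewrite inE.
- exact: measurable_funeneg.
- exact: measurable_funeneg.
- by move=> x _; apply: (@funeneg_le _ _ setT) => //; rewrite inE.
Qed.

(* Donsker-Varadhan.  The tangent bound [a + 1 - expR (a - ln r) <= ln r] also
   holds at the junk value [ln 0 = 0], so no null set has to be removed. *)
Lemma integral_le_KL (P Q : probability T R) (a : T -> R) :
  Q.-integrable setT (EFin \o a) -> \int[P]_x (expR (a x))%:E <= 1 ->
  \int[Q]_x (a x)%:E <= KL Q P.
Proof.
move=> inta expa1; rewrite /KL; case: ifPn => [/asboolP QP|_]; last exact: leey.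
have ma : measurable_fun setT a by apply/measurable_EFinP; exact: measurable_int inta.
(* A version of the density that is nonnegative and finite everywhere, for the pointwise estimates;
   it agrees with the one in [KL] almost everywhere for [P], hence for [Q]. *)
pose f := Radon_Nikodym_SigmaFinite.f Q P.
have f0 : forall x, 0 <= f x by exact: Radon_Nikodym_SigmaFinite.f_ge0.
have ff : forall x, f x \is a fin_num by exact: Radon_Nikodym_SigmaFinite.f_fin_num.
have fi : P.-integrable setT f by exact: Radon_Nikodym_SigmaFinite.f_integrable.
have mf := measurable_int _ fi.
pose r x := fine (f x).
have mr : measurable_fun setT r by exact: measurableT_comp.
have rdf : ae_eq P setT f ('d (charge_of_finite_measure Q) '/d P).
  exact: ae_eq_Radon_Nikodym_SigmaFinite.
have mlr : measurable_fun setT (fun x => ln (r x)) by exact: measurableT_comp.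
have -> : \int[Q]_x (ln (fine (('d (charge_of_finite_measure Q) '/d P) x)))%:E =
          \int[Q]_x (ln (r x))%:E.
  apply: ae_eq_integral => //.
  - apply/measurable_EFinP; apply: measurableT_comp => //.
    by apply: measurableT_comp => //; apply: measurable_int; exact: Radon_Nikodym_integrable.
  - exact/measurable_EFinP.
  - have h := null_dominates_ae_eq measurableT QP rdf.
    near=> x; move=> _; rewrite /r; congr (ln (fine _))%:E.
    by apply/esym; apply: (near h x).
pose v x := (expR (a x - ln (r x)))%:E.
have mv : measurable_fun setT v.
  by apply/measurable_EFinP/measurableT_comp => //; exact: measurable_funB.
have v0 x : 0 <= v x by rewrite lee_fin expR_ge0.
(* Passing from [Q] to [P] multiplies [v] by [r]: where [r] is positive this leaves exactly
   [expR (a x)], and where [r] is 0 it leaves 0. *)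
have intv : \int[Q]_x v x <= 1.
  rewrite -(Radon_Nikodym_SigmaFinite.change_of_variables QP)//.
  apply: le_trans expa1; apply: ge0_le_integral => //.
  - by move=> x _; rewrite mule_ge0.
  - exact: emeasurable_funM.
  - by apply/measurable_EFinP; exact: measurableT_comp.
  - move=> x _; rewrite -/f -[f x]fineK// -/(r x) /v -EFinM lee_fin.
    have [->|rx] := eqVneq (r x) 0%R; first by rewrite mulr0 expR_ge0.
    have r0 : (0 < r x)%R by rewrite lt_neqAle eq_sym rx fine_ge0.
    by rewrite expRB lnK ?posrE// divfK.
have iv : Q.-integrable setT v.
  apply/integrableP; split => //.
  under eq_integral do rewrite gee0_abs//.
  by rewrite (le_lt_trans intv)// ltry.
have i1 : Q.-integrable setT (cst 1 : T -> \bar R).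
  by apply: (finite_measure_integrable_cst _ 1%R).
have ia1 : Q.-integrable setT (fun x => (a x)%:E + 1) by exact: integrableD.
apply: (@le_trans _ _ (\int[Q]_x ((a x)%:E + 1 - v x))).
  rewrite integralB// integralD// integral_cst//= mul1e. rewrite probability_setT.
  rewrite -addeA leeDl//; rewrite leeBrDr ?add0e//.
  by rewrite ge0_fin_numE ?integral_ge0// (le_lt_trans intv)// ltry.
apply: le_integral_integrablel => //.
- exact: integrableB.
- exact/measurable_EFinP.
move=> x; rewrite [leLHS](_ : _ = (a x + 1 - expR (a x - ln (r x)))%:E)// lee_fin.
by have := expR_ge1Dx (a x - ln (r x))%R; lra.
Unshelve. all: by end_near. Qed.

(** Donsker-Varadhan for the test function [l * \1_G - c], where [c] is the logarithm of the
    [P]-mean of [expR (l * \1_G)]; the exponential of the test function then has mean 1. *)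
Lemma prob_le_KL (P Q : probability T R) (G : set T) (l : R) : measurable G ->
  l%:E * Q G - (ln (1 + (expR l - 1) * fine (P G)))%:E <= KL Q P.
Proof.
move=> mG; set c := ln _.
have PG : P G = (fine (P G))%:E by rewrite fineK// fin_num_measure.
have s0 : (0 < 1 + (expR l - 1) * fine (P G))%R.
  have p0 : (0 <= fine (P G))%R by exact: fine_ge0.
  have p1 : (fine (P G) <= 1)%R by rewrite -lee_fin -PG probability_le1.
  (* The normalizer is (1 - p) + e p, and [l] may be negative: the first summand is positive for p
     below 1/2, the second one otherwise. *)
  have := expR_gt0 l; move: (expR l) (fine (P G)) p0 p1 => e p *.
  by have [?|?] := ltrP p (1/2)%R; nra.
have iG (mu : probability T R) (x : R) :
    mu.-integrable setT (fun t => (x * \1_G t)%:E).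
  under eq_fun do rewrite EFinM.
  by apply: integrableZl => //; apply: integrable_indic => //; rewrite ltey_eq fin_num_measure.
have ic (mu : probability T R) (x : R) : mu.-integrable setT (cst x%:E).
  exact: finite_measure_integrable_cst.
have intG (mu : probability T R) (x : R) :
    \int[mu]_t (x * \1_G t)%:E = x%:E * mu G.
  under eq_integral do rewrite EFinM.
  rewrite integralZl ?integral_indic ?setIT//.
  by apply: integrable_indic => //; rewrite ltey_eq fin_num_measure.
have intc (mu : probability T R) (x : R) : \int[mu]__ x%:E = x%:E.
  by rewrite integral_cst//= probability_setT mule1.
have -> : l%:E * Q G - c%:E = \int[Q]_x (l * \1_G x - c)%:E.
  under eq_integral do rewrite EFinB.
  by rewrite integralB ?intc ?intG//; [exact: iG|exact: ic].
apply: integral_le_KL.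
  rewrite (_ : _ \o _ = (fun x => (l * \1_G x)%:E - c%:E)); last first.
    by apply/funext => x /=; rewrite EFinB.
  by apply: integrableB => //; [exact: iG|exact: ic].
have -> : (fun x => (expR (l * \1_G x - c))%:E) =
  (fun x => (expR (- c))%:E * (1 + ((expR l - 1) * \1_G x)%:E)).
  apply/funext => x; rewrite -EFinD -EFinM addrC expRD; congr (_ * _)%:E.
  by rewrite indicE; case: (x \in G); rewrite ?mulr1 ?mulr0 ?expR0; ring.
rewrite integralZl//; last by apply: integrableD => //; [exact: ic|exact: iG].
rewrite integralD//; [|exact: ic|exact: iG].
rewrite intc intG PG.
rewrite [leLHS](_ : _ = (expR (- c) * (1 + (expR l - 1) * fine (P G)))%:E)//.
rewrite lee_fin expRN lnK ?posrE//.
by rewrite mulVf// gt_eqF.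
Qed.

(** The density of [Q] is [c * \1_I]. Its logarithm is [ln c] on [I] and, by the convention ln 0 =
    0, zero outside; [1 <= c] makes both at most [ln c]. *)
Lemma KL_restr_le (P Q : probability T R) (I : set T) (c : R) :
  measurable I -> (1 <= c)%R ->
  (forall E, measurable E -> Q E = c%:E * P (E `&` I)) -> KL Q P <= (ln c)%:E.
Proof.
move=> mI c1 QE.
have QP : Q `<< P.
  move=> A nA B mB AB.
  by rewrite QE// (nA (B `&` I)) ?mule0//; [exact: measurableI|move=> x []/AB].
rewrite /KL asboolT//.
have h : ae_eq P setT ('d (charge_of_finite_measure Q) '/d P)
    (fun x => (c * \1_I x)%:E).
  apply: integral_ae_eq => //.
  - exact: Radon_Nikodym_integrable.
  - by apply/measurable_EFinP; exact: measurable_funM.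
  - move=> E _ mE; rewrite -Radon_Nikodym_integral//= QE//.
    under eq_integral do rewrite EFinM.
    rewrite ge0_integralZl//; [by rewrite integral_indic// setIC|exact/measurable_EFinP|].
    by rewrite lee_fin (le_trans _ c1).
rewrite (@ae_eq_integral _ _ _ _ _ (fun x => (ln (c * \1_I x))%:E))//; last first.
- have := null_dominates_ae_eq measurableT QP h.
  move=> {}h; near=> x; move=> _.
  by rewrite (_ : ('d _ '/d _) x = (c * \1_I x)%:E)//; apply: (near h x).
- by apply/measurable_EFinP; apply: measurableT_comp => //; exact: measurable_funM.
- apply/measurable_EFinP; apply: measurableT_comp => //.
  by apply: measurableT_comp => //; apply: measurable_int; exact: Radon_Nikodym_integrable.
have le x : (0 <= ln (c * \1_I x) <= ln c)%R.
  have lnc := ln_ge0 c1.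
  by apply/andP; rewrite indicE; case: (_ \in _); rewrite ?mulr1 ?mulr0 ?(ln0 (lexx 0%R)).
apply: (@le_trans _ _ (\int[Q]_x (ln c)%:E)); last first.
  by rewrite integral_cst//= probability_setT mule1.
apply: ge0_le_integral => //.
- by move=> x _; rewrite lee_fin; case/andP: (le x).
- by apply/measurable_EFinP; apply: measurableT_comp => //; exact: measurable_funM.
- by move=> x _; rewrite lee_fin; case/andP: (le x).
Unshelve. all: by end_near. Qed.

End relative_entropy.

(** * Weighted samples as distributions, and the prior mass of weak learners *)

Section learning_lemmas.
Context {dX : measure_display} {X : measurableType dX} {R : realType}.
Context {F : hypothesis_space X}.
Local Open Scope ereal_scope.
Implicit Types (D : probability (X * bool)%type R) (g : F) (z : X * bool).
Implicit Types (s : seq (X * bool)) (w : X * bool -> R).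

Definition err g z : bool := Defs.eval g z.1 != z.2.

Lemma measurable_err : measurable_fun setT (fun p : F * (X * bool) => err p.1 p.2).
Proof.
have mp : measurable_fun setT (fun p : F * (X * bool) => (p.1, p.2.1)).
  by apply: measurable_fun_pair => //; exact: (measurableT_comp measurable_fst).
have me : measurable_fun setT (fun p : F * (X * bool) => Defs.eval p.1 p.2.1).
  exact: (measurableT_comp (@measurable_eval _ _ F) mp).
rewrite (_ : (fun _ => _) = (fun p : F * (X * bool) =>
    if p.2.2 then ~~ Defs.eval p.1 p.2.1 else Defs.eval p.1 p.2.1)); last first.
  by apply/funext => p; rewrite /err; case: (p.2.2); case: Defs.eval.
apply: measurable_fun_ifT => //.
- exact: (measurableT_comp measurable_snd).
- exact: measurable_neg.
Qed.

Lemma measurable_err1 z : measurable_fun setT (fun g : F => err g z).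
Proof. exact: (measurable_fun_pair1 z measurable_err). Qed.

(** Through this lemma the assumptions on realizable distributions become available for every
    reweighting of a sample that boosting produces. *)
Lemma weighted_sample s w : (forall z, (0 <= w z)%R) ->
  (0 < \sum_(z <- s) w z)%R ->
  exists D, forall E, D E =
    ((\sum_(z <- s) w z * \1_E z) / \sum_(z <- s) w z)%:E.
Proof.
move=> w0 W0; case: s => [|z0 s0] in W0 *; first by rewrite big_nil ltxx in W0.
set s := z0 :: s0 in W0 *.
pose m (i : nat) := mscale (NngNum (w0 (nth z0 s i))) (dirac (nth z0 s i)).
have mE E : msum m (size s) E = (\sum_(z <- s) w z * \1_E z)%:E.
  rewrite /msum (big_nth z0) big_mkord -sumEFin; apply: eq_bigr => i _.
  by rewrite EFinM.
have WT : (\sum_(z <- s) w z * \1_[set: X * bool] z = \sum_(z <- s) w z)%R.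
  by apply: eq_bigr => z _; rewrite indicT mulr1.
exists (mnormalize (msum m (size s)) (dirac z0)) => E.
(* [mnormalize] returns its default [dirac z0] only when the total mass is zero or infinite; a
   positive finite total weight excludes both. *)
have nz : (msum m (size s) setT == 0) || (msum m (size s) setT == +oo) = false.
  by rewrite mE WT eqe gt_eqF.
rewrite [LHS](_ : _ = msum m (size s) E * (fine (msum m (size s) setT))^-1%:E).
  by rewrite !mE WT EFinM.
by rewrite /= /mnormalize; case: ifP => // h; have := etrans (esym h) nz.
Qed.

Lemma measurable_loss D : measurable_fun setT (fun g : F => loss D (Defs.eval g)).
Proof.
have mS : measurable [set p : F * (X * bool) | err p.1 p.2].
  by have := measurable_err measurableT [set true] I; rewrite setTI.
rewrite (_ : (fun _ => _) = D \o xsection [set p : F * (X * bool) | err p.1 p.2]).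
  exact: measurable_fun_xsection.
by apply/funext => g; rewrite /= /loss xsectionE; congr (D _).
Qed.

Lemma loss_ge0 D h : 0 <= loss D h.
Proof. exact: measure_ge0. Qed.

(* The Donsker-Varadhan bound is affine in the posterior, so it can be averaged
   over the sample although the kernel has no jointly measurable density. *)
Lemma prior_mass_weak_learner D (A : learning_rule R F) (k : nat)
    (P : probability F R) (gamma b : R) :
  (0 < gamma)%R -> (0 <= b)%R -> (gamma <= 1 / 2)%R ->
  measurable_fun setT (fun S : k.-tuple (X * bool)%type => KL (A S) P) ->
  expected_loss D A k <= (1 / 2 - gamma)%:E ->
  \int[iid D k]_S KL (A S) P <= b%:E ->
  (expR (- ((b + 1) / gamma)))%:E <=
    P [set g : F | loss D (Defs.eval g) <= ((1 - gamma) / 2)%:E].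
Proof.
move=> g0 b0 g12 mKL Aloss AKL; set G := (X in P X).
have mG : measurable G.
  rewrite -[G]setTI; apply: emeasurable_fun_infty_c => //.
  exact: measurable_loss.
have mGC : measurable (~` G) by exact: measurableC.
pose q (S : k.-tuple (X * bool)) := A S (~` G).
have mq : measurable_fun setT q by exact: measurable_rule.
have q0 S : 0 <= q S by exact: measure_ge0.
have iq : (iid D k).-integrable setT q.
  apply/integrableP; split => //.
  under eq_integral do rewrite gee0_abs//.
  apply: (@le_lt_trans _ _ (\int[iid D k]_S 1)); last first.
    by rewrite integral_cst//= mul1e probability_setT ltry.
  by apply: ge0_le_integral => // S _; exact: probability_le1.
have [m mE] : exists m : R, \int[iid D k]_S q S = m%:E.
  by exists (fine (\int[iid D k]_S q S)); rewrite fineK// integrable_fin_num.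
(* Markov: outside [G] the loss exceeds (1 - gamma) / 2, so (1 - gamma) / 2 * m <= 1/2 - gamma, and
   1 - 2 gamma <= (1 - gamma)^2. *)
have mle : (m <= 1 - gamma)%R.
  have : ((1 - gamma) / 2)%:E * m%:E <= (1 / 2 - gamma)%:E.
    apply: le_trans Aloss; rewrite -mE -integralZl//.
    apply: ge0_le_integral => //.
    - by move=> S _; rewrite mule_ge0// lee_fin; lra.
    - exact: measurable_funeM.
    - apply: measurable_fun_integral_kernel.
      + by move=> U mU; exact: measurable_rule.
      + by move=> g; exact: loss_ge0.
      + exact: measurable_loss.
    move=> S _; rewrite /q /gibbs_loss -(setIT (~` G)) -integral_indic// -ge0_integralZl//.
    - apply: ge0_le_integral => //.
      + by move=> g _; rewrite mule_ge0// lee_fin; lra.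
      + by apply: measurable_funeM; exact/measurable_EFinP.
      + exact: measurable_loss.
      move=> g _; rewrite indicE; case: (boolP (g \in ~` G)) => [|_];
        last by rewrite mule0 loss_ge0.
      rewrite inE /G/= => /negP; rewrite -ltNge => /ltW.
      by rewrite mule1.
    - exact/measurable_EFinP.
    - by rewrite lee_fin; lra.
  by rewrite -EFinM lee_fin; nra.
(* The slope [l] is chosen so that l (1 - m) >= l gamma = b + 1; comparing with the bound [b] forces
   c >= 1. As e >= 2, this yields (e^l - 1) P(G) >= 1, hence P(G) >= e^(-l). *)
set l := ((b + 1) / gamma)%R; set c := ln (1 + (expR l - 1) * fine (P G)).
have qle : (l * (1 - m) - c)%:E <= b%:E.
  apply: le_trans AKL.
  rewrite EFinB EFinM EFinB -mE.
  have i1 (x : R) : (iid D k).-integrable setT (cst x%:E).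
    exact: finite_measure_integrable_cst.
  have i1q : (iid D k).-integrable setT (fun S => 1 - q S).
    by apply: integrableB => //; exact: (i1 1%R).
  have il : (iid D k).-integrable setT (fun S => l%:E * (1 - q S)).
    exact: integrableZl.
  have -> : l%:E * (1 - \int[iid D k]_S q S) - c%:E =
      \int[iid D k]_S (l%:E * (1 - q S) - c%:E).
    rewrite integralB//; last exact: i1.
    rewrite integralZl// integralB//; last exact: (i1 1%R).
    by rewrite !integral_cst//= probability_setT !mule1.
  apply: le_integral_integrablel => //.
    by apply: integrableB => //; exact: i1.
  move=> S; apply: le_trans (prob_le_KL P (A S) G l mG).
  have -> // : A S G = 1 - q S.
  by rewrite -[G in LHS]setCK; exact: probability_setC.
have bl : (b + 1 = l * gamma)%R by rewrite /l divfK// gt_eqF.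
have c1 : (1 <= c)%R by rewrite lee_fin in qle; nra.
have p0 : (0 <= fine (P G))%R by exact: fine_ge0.
have e2 : (1 + 1 <= expR (1 : R))%R by exact: expR_ge1Dx.
have l0 : (0 < l)%R by rewrite -(pmulr_rgt0 _ g0) mulrC -bl; lra.
have el : (1 < expR l)%R by rewrite expR_gt1.
have s0 : (0 < 1 + (expR l - 1) * fine (P G))%R by nra.
have : (expR 1 <= 1 + (expR l - 1) * fine (P G))%R.
  by rewrite -ler_ln ?posrE ?expR_gt0// expRK.
rewrite -[P G]fineK ?fin_num_measure// lee_fin expRN => h.
by rewrite -[X in (X <= _)%R]mul1r ler_pdivrMr ?expR_gt0//; nra.
Qed.

End learning_lemmas.

(** * Boosting by random draws from the prior, and majority votes *)

Section boosting.
Context {dX : measure_display} {X : measurableType dX} {R : realType}.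
Context {F : hypothesis_space X}.
Local Open Scope ereal_scope.
Implicit Types (g : F) (z : X * bool) (s : seq (X * bool)).
Implicit Types (w : X * bool -> R) (gamma : R).

(** The multiplicative weight update of one boosting round. Reciprocal factors make the final weight
    of a point depend only on its wrong votes minus its right votes. *)
Definition boost gamma (e : bool) : R := (if e then 1 + gamma else (1 + gamma)^-1)%R.

Definition potential gamma w s (gs : seq F) : R :=
  (\sum_(z <- s) w z * \prod_(g <- gs) boost gamma (err g z))%R.

Lemma boost_gt0 gamma e : (0 < gamma)%R -> (0 < boost gamma e)%R.
Proof. by move=> g0; rewrite /boost; case: e; rewrite ?invr_gt0; lra. Qed.

Lemma measurable_boost gamma z :
  measurable_fun setT (fun g : F => boost gamma (err g z)).
Proof.
by apply: measurable_fun_ifT => //; exact: measurable_err1.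
Qed.

Lemma measurable_potential gamma w s (T : nat) :
  measurable_fun setT (fun gs : T.-tuple F => potential gamma w s gs).
Proof.
apply: measurable_sum => z; apply: measurable_funM => //.
under eq_fun do rewrite big_tuple.
apply: measurable_prod => i _.
apply: (measurableT_comp (measurable_boost gamma z)).
exact: measurable_tnth.
Qed.

Lemma potential_cons gamma w s g (gs : seq F) :
  potential gamma w s (g :: gs) =
  potential gamma (fun z => w z * boost gamma (err g z))%R s gs.
Proof.
by apply: eq_bigr => z _; rewrite big_cons mulrA.
Qed.

(** With c = 1 / (1 + gamma) the new total is c times the old one plus (1 + gamma - c) times the
    misclassified weight; inserting the error bound (1 - gamma) / 2 gives exactly the factor 1 -
    gamma^2 / 2. *)
Lemma potential_step gamma w s g : (0 < gamma)%R ->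
  (\sum_(z <- s) w z * (err g z)%:R <=
     (1 - gamma) / 2 * \sum_(z <- s) w z)%R ->
  (\sum_(z <- s) w z * boost gamma (err g z) <=
     (1 - gamma ^+ 2 / 2) * \sum_(z <- s) w z)%R.
Proof.
move=> g0 weak.
have -> : (\sum_(z <- s) w z * boost gamma (err g z) =
   (1 + gamma)^-1 * \sum_(z <- s) w z +
   (1 + gamma - (1 + gamma)^-1) * \sum_(z <- s) w z * (err g z)%:R)%R.
  rewrite !mulr_sumr -big_split/=; apply: eq_bigr => z _.
  by rewrite /boost; set i := (_^-1)%R; case: err => /=; ring.
have i1 : ((1 + gamma)^-1 <= 1)%R by rewrite invf_le1; lra.
have -> : (1 - gamma ^+ 2 / 2 = (1 + gamma)^-1 +
   (1 + gamma - (1 + gamma)^-1) * ((1 - gamma) / 2))%R.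
  by field; lra.
rewrite [leRHS]mulrDl lerD2l -[leRHS]mulrA ler_wpM2l//; lra.
Qed.

Lemma measurable_ler_cst {d : measure_display} {T : measurableType d}
    (f : T -> R) (c : R) : measurable_fun setT f ->
  measurable [set x | (f x <= c)%R].
Proof.
move=> mf.
have h : measurable_fun setT (fun x => (f x <= c)%R).
  by apply: measurable_fun_ler.
by have := h measurableT [set true] I; rewrite setTI.
Qed.

Lemma iidS {d : measure_display} {T : measurableType d} (D : probability T R)
    (n : nat) (B : set (n.+1.-tuple T)) :
  iid D n.+1 B = \int[D]_x iid D n [set y | B (cons_pair (x, y))].
Proof.
rewrite /= /distribution /pushforward/=.
by apply: eq_integral => x _; rewrite /= xsectionE.
Qed.

Lemma measurable_iidS {d : measure_display} {T : measurableType d} (D : probability T R)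
    (n : nat) (B : set (n.+1.-tuple T)) : measurable B ->
  measurable_fun setT (fun x => iid D n [set y | B (cons_pair (x, y))]).
Proof.
move=> mB.
have mB' : measurable (@cons_pair _ T n @^-1` B).
  by rewrite -[_ @^-1` _]setTI; exact: measurable_cons_pair.
rewrite (_ : (fun _ => _) = iid D n \o xsection (@cons_pair _ T n @^-1` B)).
  exact: measurable_fun_xsection.
by apply/funext => x; rewrite /= xsectionE.
Qed.

(** Induction on [T]: the first draw is a weak learner for [w] with probability at least [p], and
    then the induction hypothesis applies to the updated weights. This is why [w] is arbitrary. *)
Lemma boosting_mass (P : probability F R) gamma (p : R) s (T : nat) w :
  (0 < gamma)%R -> (gamma <= 1 / 2)%R -> (0 <= p)%R ->
  (forall w, (forall z, 0 < w z)%R ->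
     p%:E <= P [set g : F | (\sum_(z <- s) w z * (err g z)%:R <=
                         (1 - gamma) / 2 * \sum_(z <- s) w z)%R]) ->
  (forall z, 0 < w z)%R ->
  (p ^+ T)%:E <= iid P T [set gs : T.-tuple F |
     (potential gamma w s gs <=
       (1 - gamma ^+ 2 / 2) ^+ T * \sum_(z <- s) w z)%R].
Proof.
move=> g0 g12 p0 weak; elim: T w => [|T IH] w w0.
  rewrite expr0 [leRHS](_ : _ = 1)//= diracE mem_set//=.
  by rewrite /potential/= expr0 mul1r ler_sum// => z _; rewrite big_nil mulr1.
rewrite iidS.
set G := [set g : F | (\sum_(z <- s) w z * (err g z)%:R <=
                         (1 - gamma) / 2 * \sum_(z <- s) w z)%R].
have mG : measurable G.
  apply: measurable_ler_cst; apply: measurable_sum => z.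
  apply: measurable_funM => //.
  rewrite (_ : (fun _ => _) = (fun g : F => if err g z then 1 else 0)%R).
    by apply: measurable_fun_ifT => //; exact: measurable_err1.
  by apply/funext => g; case: err.
apply: (@le_trans _ _ (\int[P]_g ((p ^+ T)%:E * (\1_G g)%:E))).
  rewrite ge0_integralZl//; [|exact/measurable_EFinP|by rewrite lee_fin exprn_ge0].
  rewrite integral_indic// setIT (exprSr _ T) EFinM lee_wpmul2l ?lee_fin ?exprn_ge0//.
  exact: weak.
have mB : measurable [set gs : T.+1.-tuple F | (potential gamma w s gs <=
       (1 - gamma ^+ 2 / 2) ^+ T.+1 * \sum_(z <- s) w z)%R].
  by apply: measurable_ler_cst; exact: measurable_potential.
apply: ge0_le_integral => //.
- by move=> g _; rewrite mule_ge0// lee_fin exprn_ge0.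
- by apply: measurable_funeM; exact/measurable_EFinP.
- exact: measurable_iidS.
move=> g _; rewrite indicE; have [/set_mem Gg|_] := boolP (g \in G); last first.
  by rewrite mule0.
rewrite mule1.
have w'0 z : (0 < w z * boost gamma (err g z))%R by rewrite mulr_gt0// boost_gt0.
apply: le_trans (IH _ w'0) _.
have mB' v (c : R) : measurable [set gs : T.-tuple F | (potential gamma v s gs <= c)%R].
  by apply: measurable_ler_cst; exact: measurable_potential.
apply: le_measure; rewrite ?inE//.
  rewrite [X in measurable X](_ : _ = [set gs : T.-tuple F | (potential gamma
       (fun z => w z * boost gamma (err g z)) s gs <=
       (1 - gamma ^+ 2 / 2) ^+ T.+1 * \sum_(z <- s) w z)%R])//.
  by apply/funext => gs /=; rewrite potential_cons.
move=> gs /=; rewrite potential_cons => /le_trans; apply.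
rewrite (exprSr _ T) -[leRHS]mulrA ler_wpM2l//.
  by rewrite exprn_ge0//; nra.
exact: potential_step.
Qed.


(** Only negation and conjunction are given on [F], so the constant hypotheses are manufactured from
    an arbitrary element. *)
Definition hyp_bot (g : F) : F := hyp_and g (hyp_neg g).

Definition hyp_top (g : F) : F := hyp_neg (hyp_bot g).

Definition hyp_or (g1 g2 : F) : F :=
  hyp_neg (hyp_and (hyp_neg g1) (hyp_neg g2)).

(** Counting votes as a Boolean circuit keeps the result inside [F] and measurable in the voters: at
    least [j] votes arise with the head among them, or from the tail alone. *)
Fixpoint threshold (g0 : F) (j : nat) (gs : seq F) {struct gs} : F :=
  match gs, j with
  | _, 0%N => hyp_top g0
  | [::], _.+1 => hyp_bot g0
  | g :: gs', j'.+1 =>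
      hyp_or (hyp_and g (threshold g0 j' gs')) (threshold g0 j gs')
  end.

Lemma eval_threshold g0 j gs x :
  Defs.eval (threshold g0 j gs) x = (j <= count (fun g => Defs.eval g x) gs)%N.
Proof.
elim: gs j => [|g gs IH] [|j] /=; rewrite /hyp_top /hyp_or ?eval_neg !eval_and ?eval_neg.
- by rewrite andbN.
- by rewrite andbN.
- by rewrite andbN.
rewrite eval_and !IH negb_and !negbK; case: (Defs.eval g x) => //=.
rewrite add1n ltnS; case: ltnP => [/ltnW ->//|]; by rewrite orbF.
Qed.

Lemma measurable_hyp_or {d : measure_display} {T : measurableType d}
    (f g : T -> F) : measurable_fun setT f -> measurable_fun setT g ->
  measurable_fun setT (fun x => hyp_or (f x) (g x)).
Proof.
have mneg (h : T -> F) : measurable_fun setT h ->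
    measurable_fun setT (fun x => hyp_neg (h x)).
  exact: (measurableT_comp (@measurable_hyp_neg _ _ F)).
move=> mf mg; apply: (mneg _).
exact: (measurableT_comp (@measurable_hyp_and _ _ F)
  (measurable_fun_pair (mneg _ mf) (mneg _ mg))).
Qed.

Lemma measurable_threshold g0 j T :
  measurable_fun setT (fun gs : T.-tuple F => threshold g0 j gs).
Proof.
elim: T j => [|T IH] j.
  rewrite (_ : (fun _ => _) = cst (threshold g0 j [::])); first exact: measurable_cst.
  by apply/funext => gs; rewrite [gs]tuple0.
case: j => [|j].
  rewrite (_ : (fun _ => _) = cst (hyp_top g0)); first exact: measurable_cst.
  by apply/funext => gs; case/tupleP: gs.
have mb : measurable_fun setT (fun gs : T.+1.-tuple F => [tuple of behead gs]).
  apply/measurable_fun_tnthP => i.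
  rewrite (_ : _ \o _ = (@tnth _ F)^~ (lift ord0 i)); first exact: measurable_tnth.
  by apply/funext => gs; case/tupleP: gs => g gs /=; rewrite tnthS; congr tnth; exact: val_inj.
have mh : measurable_fun setT (fun gs : T.+1.-tuple F => tnth gs ord0).
  exact: measurable_tnth.
rewrite (_ : (fun _ => _) = (fun gs : T.+1.-tuple F =>
    hyp_or (hyp_and (tnth gs ord0) (threshold g0 j [tuple of behead gs]))
           (threshold g0 j.+1 [tuple of behead gs]))); last first.
  by apply/funext => gs; case/tupleP: gs => g gs /=; rewrite tnth0.
apply: measurable_hyp_or.
  exact: (measurableT_comp (@measurable_hyp_and _ _ F)
    (measurable_fun_pair mh (measurableT_comp (IH j) mb))).
exact: (measurableT_comp (IH j.+1) mb).
Qed.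

(** [uphalf] makes a tie predict [true]; a wrong prediction still means at least as many wrong votes
    as right ones. *)
Definition majority (g0 : F) (T : nat) (gs : T.-tuple F) : F :=
  threshold g0 (uphalf T) gs.

Lemma majority_err g0 T (gs : T.-tuple F) z : err (majority g0 T gs) z ->
  (count (fun g => ~~ err g z) gs <= count (fun g => err g z) gs)%N.
Proof.
have E : (count (fun g => err g z) gs + count (fun g => ~~ err g z) gs = T)%N.
  by rewrite (count_predC (fun g => err g z)) size_tuple.
have U := odd_double_half T.
have U' : (uphalf T = odd T + T./2)%N by exact: uphalf_half.
case: z => x [] in E *.
  rewrite {1}/err /majority eval_threshold /=.
  have -> : count (fun g => Defs.eval g x) gs = count (fun g => ~~ err g (x, true)) gs.
    by apply: eq_count => g; rewrite /err/= negbK eqb_id.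
  by rewrite eqb_id; lia.
rewrite {1}/err /majority eval_threshold /=.
have -> : count (fun g => Defs.eval g x) gs = count (fun g => err g (x, false)) gs.
  by apply: eq_count => g; rewrite /err/= eqbF_neg negbK.
by rewrite eqbF_neg negbK; lia.
Qed.

(** The product is 1 + gamma to the power of wrong minus right votes; moving the right votes to the
    other side avoids a negative exponent. *)
Lemma prod_boost gamma (gs : seq F) z : (0 < gamma)%R ->
  (\prod_(g <- gs) boost gamma (err g z) * (1 + gamma) ^+ count (fun g => ~~ err g z) gs
   = (1 + gamma) ^+ count (fun g => err g z) gs)%R.
Proof.
move=> g0; elim: gs => [|g gs IH]; first by rewrite big_nil mul1r.
rewrite big_cons /= /boost; case: err => /=; rewrite ?add0n add1n exprS -IH.
  by rewrite mulrA.
by field; lra.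
Qed.

Definition interpolants s : set F := [set g | all (fun z => ~~ err g z) s].

(** A sample point that the vote misclassifies has at least as many wrong as right votes, so its own
    weight is at least 1 and already pushes the potential up to 1. *)
Lemma potential_lt1_majority g0 gamma s T (gs : T.-tuple F) : (0 < gamma)%R ->
  (potential gamma (cst 1%R) s gs < 1)%R -> interpolants s (majority g0 T gs).
Proof.
move=> gamma0 pot1; apply/allP => z zs; apply/negP => ez.
have b0 z' : (0 <= cst 1%R z' * \prod_(g <- gs) boost gamma (err g z'))%R.
  by rewrite mul1r prodr_ge0// => g _; rewrite ltW// boost_gt0.
have : (1 <= potential gamma (cst 1%R) s gs)%R; last by rewrite leNgt pot1.
rewrite /potential (big_rem z)//= mul1r.
apply: (@le_trans _ _ (\prod_(g <- gs) boost gamma (err g z))%R); last first.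
  by rewrite lerDl; apply: sumr_ge0 => z1 _; exact: b0.
have c1 : (0 < (1 + gamma) ^+ count (fun g => ~~ err g z) gs)%R.
  by rewrite exprn_gt0//; lra.
rewrite -(ler_pM2r c1) prod_boost// mul1r ler_weXn2l//; first lra.
exact: majority_err ez.
Qed.

Lemma measurable_majority g0 T : measurable_fun setT (majority g0 T).
Proof. exact: measurable_threshold. Qed.

HB.instance Definition _ g0 T :=
  @isMeasurableFun.Build _ _ _ _ (majority g0 T) (measurable_majority g0 T).

(** Unit weights start the potential at [size s], and [T] rounds of contraction bring it below 1. *)
Lemma majority_mass (P : probability F R) g0 gamma (p : R) s (T : nat) :
  (0 < gamma)%R -> (gamma <= 1 / 2)%R -> (0 <= p)%R ->
  ((1 - gamma ^+ 2 / 2) ^+ T * (size s)%:R < 1)%R ->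
  (forall w, (forall z, 0 < w z)%R ->
     p%:E <= P [set g : F | (\sum_(z <- s) w z * (err g z)%:R <=
                         (1 - gamma) / 2 * \sum_(z <- s) w z)%R]) ->
  measurable (interpolants s) ->
  (p ^+ T)%:E <= iid P T (majority g0 T @^-1` interpolants s).
Proof.
move=> gamma0 g12 p0 sT weak mI.
have w0 (z : X * bool) : (0 < cst (1 : R) z)%R by [].
apply: le_trans (boosting_mass P gamma p s T _ gamma0 g12 p0 weak w0) _.
have mB c : measurable [set gs : T.-tuple F | (potential gamma (cst 1) s gs <= c)%R].
  by apply: measurable_ler_cst; exact: measurable_potential.
apply: le_measure; rewrite ?inE//.
  by rewrite -[_ @^-1` _]setTI; exact: measurable_majority.
move=> gs /= le1; apply: (potential_lt1_majority _ gamma) => //.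
apply: le_lt_trans le1 _.
by rewrite big_const_seq count_predT iter_addr addr0 .
Qed.

Lemma measurable_interpolants s : measurable (interpolants s).
Proof.
have h : measurable_fun setT (fun g : F => all (fun z => ~~ err g z) s).
  elim: s => [|z s IH]; first exact: measurable_cst.
  apply: measurable_and => //; apply: measurable_neg; exact: measurable_err1.
by have := h measurableT [set true] I; rewrite setTI.
Qed.

End boosting.

(** * Realizable samples and realizable distributions *)

Section samples.
Context {dX : measure_display} {X : measurableType dX} {R : realType}.
Context {F : hypothesis_space X}.
Local Open Scope ereal_scope.
Implicit Types (D : probability (X * bool)%type R) (H : set (X -> bool)).
Implicit Types (s : seq (X * bool)) (h : X -> bool).

Lemma emp_loss0P s h : emp_loss R s h = 0%R <-> all (fun z => h z.1 == z.2) s.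
Proof.
rewrite /emp_loss; case: s => [|z s]; first by rewrite big_nil mul0r.
set s' := z :: s; rewrite (rwP eqP) mulf_eq0 invr_eq0 pnatr_eq0 orbF.
rewrite psumr_eq0//; split=> /allP a; apply/allP => y /a /=.
  by rewrite pnatr_eq0 eqb0 negbK.
by rewrite pnatr_eq0 eqb0 negbK.
Qed.

Lemma interpolantsE s :
  [set g : F | emp_loss R s (Defs.eval g) = 0%R] = interpolants s.
Proof.
have E (g : F) : all (fun z => Defs.eval g z.1 == z.2) s = all (fun z => ~~ err g z) s.
  by apply: eq_all => z; rewrite /err negbK.
by apply/seteqP; split => g /=; rewrite emp_loss0P E.
Qed.

(** The normalized weights form a realizable distribution, because a hypothesis fitting the sample
    has loss 0 under them; weak learners for it are those with small weighted error. *)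
Lemma prior_mass_weak_sample H s (w : X * bool -> R) (A : learning_rule R F)
    (k : nat) (P : probability F R) (gamma b : R) :
  (0 < gamma)%R -> (0 <= b)%R -> (gamma <= 1 / 2)%R ->
  measurable_fun setT (fun S : k.-tuple (X * bool)%type => KL (A S) P) ->
  (forall D, realizable H D -> expected_loss D A k <= (1 / 2 - gamma)%:E) ->
  (forall D, realizable H D -> \int[iid D k]_S KL (A S) P <= b%:E) ->
  realizable_sample R H s -> (forall z, 0 < w z)%R ->
  (expR (- ((b + 1) / gamma)))%:E <=
    P [set g : F | (\sum_(z <- s) w z * (err g z)%:R <=
                      (1 - gamma) / 2 * \sum_(z <- s) w z)%R].
Proof.
move=> g0 b0 g12 mKL Aloss AKL [h Hh /emp_loss0P sh] w0.
(* The empty sample carries no distribution, but there the inequality reads 0 <= 0 and the event is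
   everything. *)
case: s => [|z0 s0] in sh *.
  rewrite [X in P X](_ : _ = setT); last first.
    by apply/seteqP; split => // g _ /=; rewrite !big_nil mulr0.
  rewrite probability_setT lee_fin expR_le1 oppr_le0 divr_ge0//; lra.
set s := z0 :: s0 in sh *.
have W0 : (0 < \sum_(z <- s) w z)%R.
  rewrite big_cons ltr_pwDl//; apply: sumr_ge0 => z _; exact: ltW.
have [D DE] := weighted_sample s w (fun z => ltW (w0 z)) W0.
have rD : realizable H D.
  apply/eqP; rewrite eq_le; apply/andP; split.
    apply: ereal_inf_lbound; exists h => //.
    rewrite /loss DE big_seq big1 ?mul0r// => z zs.
    rewrite indicE memNset ?mulr0//= => /negP; apply.
    exact: (allP sh).
  by apply: le_ereal_inf_tmp => _ [h' _ <-]; exact: loss_ge0.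
have := prior_mass_weak_learner D A k P gamma b g0 b0 g12 mKL (Aloss D rD) (AKL D rD).
congr (_ <= P _); apply/funext => g /=; rewrite /loss DE lee_fin ler_pdivrMr//.
by congr (_ <= _)%R; apply: eq_bigr => z _; rewrite indicE mem_setE.
Qed.

Lemma iid_all {d : measure_display} {T : measurableType d} (D : probability T R)
    (a : T -> bool) (m : nat) : measurable_fun setT a ->
  iid D m [set S : m.-tuple T | all a S] = (fine (D [set z | a z]) ^+ m)%:E.
Proof.
move=> ma; have mA : measurable [set z | a z].
  by have := ma measurableT [set true] I; rewrite setTI.
elim: m => [|m IH].
  rewrite expr0.
  rewrite [LHS](_ : _ = \d_([tuple] : 0.-tuple T) [set S : 0.-tuple T | all a S])//.
  by rewrite diracE mem_set.
rewrite iidS.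
under eq_integral => x _.
  rewrite (_ : iid D m _ = (fine (D [set z | a z]) ^+ m)%:E * (\1_[set z | a z] x)%:E); last first.
    rewrite -IH indicE; have [ax|nax] := boolP (a x).
      rewrite mem_set// mule1; congr (iid D m _).
      by apply/seteqP; split => y /=; rewrite ax.
    rewrite memNset ?mule0//=; last exact/negP.
    rewrite (_ : [set y | _] = set0) ?measure0//.
    by apply/seteqP; split => y //=; rewrite (negbTE nax).
  over.
rewrite ge0_integralZl//; [|exact/measurable_EFinP|by rewrite lee_fin exprn_ge0// fine_ge0].
by rewrite integral_indic// setIT exprSr EFinM fineK// fin_num_measure.
Qed.

Lemma measurable_all_tuple {d : measure_display} {T : measurableType d}
    (a : T -> bool) (m : nat) : measurable_fun setT a ->
  measurable [set S : m.-tuple T | all a S].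
Proof.
move=> ma; have h : measurable_fun setT (fun S : m.-tuple T => all a S).
  rewrite (_ : (fun _ => _) = (fun S : m.-tuple T => all (fun i => a (tnth S i)) (enum 'I_m))).
    elim: (enum 'I_m) => [|i l IH]; first exact: measurable_cst.
    apply: measurable_and => //.
    exact: (measurableT_comp ma (measurable_tnth i)).
  by apply/funext => S; rewrite -[in LHS](map_tnth_enum S) all_map.
by have := h measurableT [set true] I; rewrite setTI.
Qed.

Lemma bernoulli_ineq (x : R) (m : nat) : (0 <= x <= 1)%R ->
  (1 - m%:R * x <= (1 - x) ^+ m)%R.
Proof.
move=> /andP[x0 x1]; elim: m => [|m IH]; first by rewrite expr0 mul0r subr0.
rewrite exprS -natr1; have : (0 <= m%:R * x :> R)%R by rewrite mulr_ge0.
have : (0 <= (1 - x) * ((1 - x) ^+ m - (1 - m%:R * x)))%R.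
  by rewrite mulr_ge0 ?subr_ge0.
by have := ler0n R m; nra.
Qed.

(** The infimum 0 need not be attained, so hypotheses [h n] of loss below 1 / (n + 1) are chosen. By
    Bernoulli's inequality [h n] fails to fit the sample with probability at most m / (n + 1), and a
    non-realizable sample lies in all these failure events. *)
Lemma ae_realizable_sample H D (m : nat) :
  (forall h, H h -> measurable_fun setT h) -> realizable H D ->
  {ae iid D m, forall S : m.-tuple (X * bool)%type, realizable_sample R H S}.
Proof.
move=> mH rD.
have /choice[h hP] : forall n : nat, exists h, H h /\ loss D h < (n.+1%:R^-1)%:E.
  move=> n; have : ereal_inf [set loss D h | h in H] < (n.+1%:R^-1)%:E.
    by rewrite rD lte_fin invr_gt0.
  by move=> /ereal_inf_lt[_ [h Hh <-] hn]; exists h.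
pose ok n (z : X * bool) := h n z.1 == z.2.
have mok n : measurable_fun setT (ok n).
  have mh : measurable_fun setT (fun z : X * bool => h n z.1).
    exact: (measurableT_comp (mH _ (hP n).1)).
  rewrite (_ : ok n = (fun z => if z.2 then h n z.1 else ~~ h n z.1)).
    by apply: measurable_fun_ifT => //; exact: measurable_neg.
  by apply/funext => z; rewrite /ok; case: z.2; rewrite ?eqb_id ?eqbF_neg.
pose N := \bigcap_n ~` [set S : m.-tuple (X * bool) | all (ok n) S].
have mC n : measurable (~` [set S : m.-tuple (X * bool) | all (ok n) S]).
  by apply: measurableC; exact: measurable_all_tuple.
have mN : measurable N by exact: bigcapT_measurable.
exists N; split => //; last first.
  move=> S /= nS n _ /= okS; apply: nS; exists (h n); first exact: (hP n).1.
  exact/emp_loss0P.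
have Nle n : iid D m N <= (m%:R * n.+1%:R^-1)%:E.
  apply: (@le_trans _ _ (iid D m (~` [set S : m.-tuple (X * bool) | all (ok n) S]))).
    by apply: le_measure; rewrite ?inE//; exact: bigcap_inf.
  rewrite probability_setC; last exact: measurable_all_tuple.
  have moks : measurable [set z | ok n z].
    by have := mok n measurableT [set true] I; rewrite setTI.
  rewrite iid_all// -EFinB lee_fin.
  have lossE : loss D (h n) = 1 - D [set z | ok n z].
    by rewrite -probability_setC// /loss; congr (D _); apply/seteqP; split => z /=; move/negP.
  have Df : D [set z | ok n z] = (fine (D [set z | ok n z]))%:E.
    by rewrite fineK// fin_num_measure.
  have := (hP n).2; rewrite lossE Df lte_fin.
  have : (fine (D [set z | ok n z]) <= 1)%R.
    by rewrite -lee_fin -Df probability_le1.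
  have : (0 <= fine (D [set z | ok n z]))%R by exact: fine_ge0.
  move: (fine _) => x x0 x1 xn.
  have := bernoulli_ineq (1 - x)%R m; rewrite subKr => /(_ _)-B.
  have {B} : (1 - m%:R * (1 - x) <= x ^+ m)%R by apply: B; lra.
  have : (m%:R * (1 - x) <= m%:R * n.+1%:R^-1 :> R)%R by rewrite ler_wpM2l// ltW.
  by move=> le1 le2; apply: le_trans le1; rewrite /= lerBlDr addrC -lerBlDr.
have Nf : iid D m N = (fine (iid D m N))%:E by rewrite fineK// fin_num_measure.
apply/eqP; rewrite eq_le measure_ge0 andbT Nf lee_fin leNgt; apply/negP => N0.
move: (Nle); rewrite Nf; set x := fine _ in N0 * => xle.
(* Archimedean choice: n + 1 exceeds m / x, contradicting x <= m / (n + 1). *)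
pose n := Num.truncn (m%:R / x).
have := xle n; rewrite lee_fin ler_pdivlMr// => h1.
have := truncnS_gt (m%:R / x); rewrite -/n ltr_pdivrMr// mulrC; lra.
Qed.

End samples.

(** * The prior conditioned on interpolation: kernel, divergence and loss *)

Section posterior.
Context {dX : measure_display} {X : measurableType dX} {R : realType}.
Context {F : hypothesis_space X}.
Local Open Scope ereal_scope.
Implicit Types (D : probability (X * bool)%type R) (H : set (X -> bool)).
Implicit Types (s : seq (X * bool)) (M : probability F R).

(** One prior has to serve all sample sizes, hence all numbers of rounds; geometric weights cost
    only (n + 1) ln 2 in the divergence. *)
Lemma countable_mixture {d : measure_display} {T : measurableType d}
    (Q : nat -> probability T R) :
  exists M : probability T R, forall n E, ((2 ^+ n.+1)^-1)%:E * Q n E <= M E.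
Proof.
have w0 n : (0 <= 1 / (2 ^ (n + 1))%:R :> R)%R by rewrite divr_ge0.
pose m := mseries (fun n => mscale (NngNum (w0 n)) (Q n)) 0.
have m1 : m setT = 1.
  have mE n : mscale (NngNum (w0 n)) (Q n) setT = (1 / (2 ^ (n + 1))%:R)%:E.
    by rewrite -[RHS]mule1 -(@probability_setT _ _ _ (Q n)).
  rewrite /m /mseries (eq_eseriesr (fun n _ => mE n)).
  by apply/cvg_lim => //; have := @cvg_geometric_eseries_half R 1 0; rewrite expr0 divr1.
have nz : (m setT == 0) || (m setT == +oo) = false by rewrite m1 eqe oner_eq0.
exists (mnormalize m (Q 0%N)) => n E.
rewrite [leRHS](_ : _ = m E * (fine (m setT))^-1%:E); last first.
  by rewrite /= /mnormalize; case: ifP => // h; have := etrans (esym h) nz.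
rewrite m1 invr1 mule1.
apply: (@le_trans _ _ (\sum_(0 <= i < n.+1) mscale (NngNum (w0 i)) (Q i) E)).
  rewrite big_nat_recr//= /mscale/= addn1 natrX div1r.
  by rewrite leeDr// sume_ge0// => i _; rewrite mule_ge0.
by apply: nneseries_lim_ge => i _ _; exact: measure_ge0.
Qed.

(** If the interpolants have mass 0, the value is the default [M], so the rule is total on
    samples. *)
Definition posterior M s : probability F R :=
  mnormalize (mrestr M (measurable_interpolants s)) M.

Lemma posteriorE M s E : 0 < M (interpolants s) ->
  posterior M s E = ((fine (M (interpolants s)))^-1)%:E * M (E `&` interpolants s).
Proof.
move=> MI; set mu := mrestr M (measurable_interpolants s).
have muT : mu setT = M (interpolants s) by rewrite /mu /mrestr setTI.
have nz : (mu setT == 0) || (mu setT == +oo) = false.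
  by rewrite muT gt_eqF//= lt_eqF// ltey_eq fin_num_measure//; exact: measurable_interpolants.
rewrite [LHS](_ : _ = mu E * (fine (mu setT))^-1%:E); last first.
  by rewrite /= /mnormalize; case: ifP => // h; have := etrans (esym h) nz.
by rewrite muT muleC.
Qed.

Lemma measurable_err_set (g : F) : measurable [set z : X * bool | err g z].
Proof.
have h := measurable_fun_pair2 g (@measurable_err _ _ F).
by have := h measurableT [set true] I; rewrite setTI.
Qed.

(** Joint measurability serves both the kernel property of the posterior and the exchange of
    integrals in the loss bound. *)
Lemma measurable_interpolating_pairs (m : nat) (E : set F) : measurable E ->
  measurable [set p : m.-tuple (X * bool) * F | interpolants p.1 p.2 /\ E p.2].
Proof.
move=> mE; apply: measurableI; last first.
  by have := @measurable_snd _ _ (m.-tuple (X * bool)) F measurableT _ mE; rewrite setTI.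
have h : measurable_fun setT (fun p : m.-tuple (X * bool) * F =>
    all (fun z => ~~ err p.2 z) p.1).
  rewrite (_ : (fun _ => _) = (fun p : m.-tuple (X * bool) * F =>
      all (fun i => ~~ err p.2 (tnth p.1 i)) (enum 'I_m))).
    elim: (enum 'I_m) => [|i l IH]; first exact: measurable_cst.
    apply: measurable_and => //; apply: measurable_neg.
    apply: (measurableT_comp measurable_err (measurable_fun_pair measurable_snd _)).
    exact: (measurableT_comp (measurable_tnth i) measurable_fst).
  by apply/funext => p; rewrite -[in LHS](map_tnth_enum p.1) all_map.
by have := h measurableT [set true] I; rewrite setTI.
Qed.

Lemma interpolating_pairs_xsection (m : nat) (E : set F) (S : m.-tuple (X * bool)) :
  xsection [set p : m.-tuple (X * bool) * F | interpolants p.1 p.2 /\ E p.2] S =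
  E `&` interpolants S.
Proof. by rewrite xsectionE setIC. Qed.

Section kernel.
Variables (M : probability F R) (m : nat).

Let restr (S : m.-tuple (X * bool)) : {measure set F -> \bar R} :=
  mrestr M (measurable_interpolants S).

Let measurable_restr E : measurable E -> measurable_fun setT (restr ^~ E).
Proof.
move=> mE; pose A := [set p : m.-tuple (X * bool) * F | interpolants p.1 p.2 /\ E p.2].
rewrite (_ : (fun _ => _) = M \o xsection A).
  by apply: measurable_fun_xsection; exact: measurable_interpolating_pairs.
by apply/funext => S; rewrite /= interpolating_pairs_xsection.
Qed.

HB.instance Definition _ := isKernel.Build _ _ _ _ _ restr measurable_restr.

(** The posterior is the pointwise normalization of the kernel [restr], which is again a kernel. *)
Lemma measurable_posterior E : measurable E ->
  measurable_fun setT (fun S : m.-tuple (X * bool) => posterior M S E).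
Proof. by move=> mE; exact: (measurable_kernel (knormalize restr M) E mE). Qed.

End kernel.

Definition posterior_rule M : learning_rule R F :=
  @LearningRule _ _ R F (posterior M) (measurable_posterior M).

Lemma posterior_rule_interpolating M H :
  (forall s, realizable_sample R H s -> 0 < M (interpolants s)) ->
  interpolating H (posterior_rule M).
Proof.
move=> MI s rs; rewrite interpolantsE /= (_ : posterior M s _ = 1)//.
rewrite posteriorE; last exact: MI.
rewrite setIid -[X in _ * X]fineK; last first.
  by apply: fin_num_measure; exact: measurable_interpolants.
by rewrite -EFinM mulVf// fine_eq0 ?gt_eqF ?MI// fin_num_measure//; exact: measurable_interpolants.
Qed.

(** The density is the inverse mass of the interpolants on them and 0 elsewhere, as [KL_restr_le]
    requires. *)
Lemma KL_posterior_le M s (c : R) : (0 < c)%R -> c%:E <= M (interpolants s) ->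
  KL (posterior M s) M <= (- ln c)%:E.
Proof.
move=> c0 cM; have mI := @measurable_interpolants _ _ F s.
have Mf : M (interpolants s) = (fine (M (interpolants s)))%:E.
  by rewrite fineK// fin_num_measure.
have M0 : 0 < M (interpolants s) by rewrite (lt_le_trans _ cM).
have f1 : (fine (M (interpolants s)) <= 1)%R by rewrite -lee_fin -Mf probability_le1.
have fc : (c <= fine (M (interpolants s)))%R by rewrite -lee_fin -Mf.
have f0 := lt_le_trans c0 fc.
apply: (le_trans (KL_restr_le M (posterior M s) (interpolants s)
    (fine (M (interpolants s)))^-1 mI _ _)).
- by rewrite invf_ge1.
- by move=> E _; rewrite posteriorE.
by rewrite lee_fin lnV ?posrE// lerN2 ler_ln ?posrE.
Qed.

(* The event {loss > e} does not depend on the sample, so by Fubini the expected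
   prior mass of the interpolants in it is at most (1 - e)^m, and the posterior
   is at most 1/c times the prior. *)
Lemma expected_loss_posterior_le M D (m : nat) (c e : R) : (0 < c)%R -> (0 <= e)%R ->
  {ae iid D m, forall S : m.-tuple (X * bool)%type, c%:E <= M (interpolants S)} ->
  expected_loss D (posterior_rule M) m <= (e + c^-1 * expR (- (e * m%:R)))%:E.
Proof.
move=> c0 e0 aec; pose G := [set g : F | e%:E < loss D (Defs.eval g)].
have mG : measurable G.
  rewrite -[G]setTI; apply: emeasurable_fun_o_infty => //; exact: measurable_loss.
pose A := [set p : m.-tuple (X * bool) * F | interpolants p.1 p.2 /\ G p.2].
have mA : measurable A by exact: measurable_interpolating_pairs.
have mMA : measurable_fun setT (fun S : m.-tuple (X * bool) => M (G `&` interpolants S)).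
  rewrite (_ : (fun _ => _) = M \o xsection A); first exact: measurable_fun_xsection.
  by apply/funext => S; rewrite /= interpolating_pairs_xsection.
have iM0 : (0 <= c^-1)%R by rewrite invr_ge0 ltW.
(* The loss is at most [e] outside [G] and at most 1 on [G], so the Gibbs loss is at most [e] plus
   the posterior mass of [G]. *)
apply: (@le_trans _ _ (\int[iid D m]_S (e%:E + (c^-1)%:E * M (G `&` interpolants S)))).
  apply: ae_ge0_le_integral => //.
  - by move=> S _; apply: integral_ge0 => g _; exact: loss_ge0.
  - apply: measurable_fun_integral_kernel.
    + by move=> U mU; exact: measurable_posterior.
    + by move=> g; exact: loss_ge0.
    + exact: measurable_loss.
  - by move=> S _; rewrite adde_ge0// ?lee_fin// mule_ge0.
  - by apply: emeasurable_funD => //; exact: measurable_funeM.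
  move: aec; apply: filterS => S cS _.
  have mI := @measurable_interpolants _ _ F S.
  have Mf : M (interpolants S) = (fine (M (interpolants S)))%:E.
    by rewrite fineK// fin_num_measure.
  have fc : (c <= fine (M (interpolants S)))%R by rewrite -lee_fin -Mf.
  apply: (@le_trans _ _ (\int[posterior M S]_g (e%:E + (\1_G g)%:E))).
    apply: ge0_le_integral => //.
    - exact: measurable_loss.
    - by apply: emeasurable_funD => //; exact/measurable_EFinP.
    move=> g _; rewrite indicE; have [_|/negP] := boolP (g \in G).
      apply: (@le_trans _ _ 1); last by rewrite leeDr ?lee_fin.
      apply: probability_le1; exact: measurable_err_set.
    by rewrite adde0 inE /G/= => /negP; rewrite -leNgt.
  rewrite ge0_integralD//; last exact/measurable_EFinP.
  rewrite integral_cst//= probability_setT mule1 integral_indic// setIT.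
  rewrite leeD2l// [leLHS](_ : _ = posterior M S G)//.
  rewrite posteriorE ?(lt_le_trans _ cS)// lee_wpmul2r// lee_fin.
  by rewrite lef_pV2 ?posrE// (lt_le_trans c0).
rewrite ge0_integralD//; [|by move=> S _; rewrite mule_ge0|exact: measurable_funeM].
rewrite integral_cst//= probability_setT mule1 EFinD leeD2l//.
rewrite ge0_integralZl// EFinM lee_wpmul2l//.
have -> : \int[iid D m]_S M (G `&` interpolants S) =
    \int[M]_g iid D m (ysection A g).
  have := indic_fubini_tonelli (iid D m) M mA.
  rewrite indic_fubini_tonelli_FE// indic_fubini_tonelli_GE//= => <-.
  by apply: eq_integral => S _; rewrite /= interpolating_pairs_xsection.
apply: (@le_trans _ _ (\int[M]_g (expR (- (e * m%:R)))%:E)); last first.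
  by rewrite integral_cst//= probability_setT mule1.
apply: ge0_le_integral => //.
  exact: measurable_fun_ysection.
move=> g _; have [Gg|nGg] := pselect (G g); last first.
  rewrite (_ : ysection A g = set0) ?measure0 ?lee_fin ?expR_ge0//.
  by rewrite ysectionE; apply/seteqP; split => // S [].
have mok : measurable_fun setT (fun z => ~~ err g z).
  by apply: measurable_neg; exact: (measurable_fun_pair2 g measurable_err).
have moks : measurable [set z | ~~ err g z].
  by have := mok measurableT [set true] I; rewrite setTI.
rewrite (_ : ysection A g =
    [set S : m.-tuple (X * bool) | all (fun z => ~~ err g z) S]); last first.
  by rewrite ysectionE; apply/seteqP; split => [S []|S].
rewrite iid_all// lee_fin -mulNr mulrC expRM_natl.
have D0 : (0 <= fine (D [set z | ~~ err g z]))%R by exact: fine_ge0.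
apply: lerXn2r => //; rewrite ?nnegrE ?expR_ge0//.
apply: le_trans (expR_ge1Dx _).
have : e%:E < 1 - D [set z | ~~ err g z].
  rewrite -probability_setC//; apply: lt_le_trans Gg _.
  rewrite (_ : ~` _ = [set z | err g z])//.
  by apply/funext => z /=; rewrite propeqE (rwP negP) negbK.
rewrite -[D _]fineK ?fin_num_measure// -EFinB lte_fin; lra.
Qed.

End posterior.

(** * Explicit rates and their asymptotics *)

Section rates.
Context {R : realType}.
Implicit Types (gamma b : R) (m : nat).

Definition rate gamma : R := - ln (1 - gamma ^+ 2 / 2).

(** Enough rounds to contract the potential from [m] to below 1. The successor inside [ln] covers m
    = 0; the outer one makes the bound strict after truncation. *)
Definition rounds gamma m : nat := (Num.truncn (ln m.+1%:R / rate gamma)).+1.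

(** Minus the logarithm of the guaranteed interpolant mass: with T rounds, the mixture weight 2^-(T
    + 1) times p^T for p = exp(-(b + 1) / gamma). *)
Definition kl_rate gamma b m : R :=
  (rounds gamma m).+1%:R * ln 2 + (rounds gamma m)%:R * ((b + 1) / gamma).

(** For positive [m] this level makes the exponential term of [loss_rate] equal to 1 / m; at m = 0
    division by zero makes it 0. *)
Definition loss_level gamma b m : R := (kl_rate gamma b m + ln m%:R) / m%:R.

Definition loss_rate gamma b m : R := loss_level gamma b m +
  expR (kl_rate gamma b m) * expR (- (loss_level gamma b m * m%:R)).

Lemma rate_gt0 gamma : 0 < gamma -> gamma <= 1 / 2 -> 0 < rate gamma.
Proof. by move=> g0 g12; rewrite oppr_gt0 ln_lt0//; apply/andP; split; nra. Qed.

Lemma rounds_lt1 gamma m : 0 < gamma -> gamma <= 1 / 2 ->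
  (1 - gamma ^+ 2 / 2) ^+ rounds gamma m * m%:R < 1.
Proof.
move=> g0 g12; have k0 := rate_gt0 _ g0 g12.
set r := 1 - _; have r0 : 0 < r by rewrite /r; nra.
have := truncnS_gt (ln m.+1%:R / rate gamma); rewrite -/(rounds gamma m).
rewrite ltr_pdivrMr// => h.
have rT : r ^+ rounds gamma m < m.+1%:R^-1.
  rewrite -ltr_ln ?posrE ?invr_gt0 ?exprn_gt0//.
  by rewrite lnXn// lnV ?posrE// -[ln r *+ _]mulr_natl ltrNr -mulrN.
apply: (@le_lt_trans _ _ (r ^+ rounds gamma m * m.+1%:R)).
  by rewrite ler_wpM2l ?ler_nat// exprn_ge0// ltW.
by rewrite -ltr_pdivlMr// div1r.
Qed.

(** Because m + 1 <= m^2; this is the source of the factor 2 in the bound on [rounds]. *)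
Lemma ln_succ_le m : (2 <= m)%N -> ln m.+1%:R <= 2 * ln m%:R :> R.
Proof.
move=> m2; have m0 : 0 < m%:R :> R by rewrite ltr0n; lia.
rewrite mulr_natl -lnXn// ler_ln ?posrE ?exprn_gt0// -natrX ler_nat; nia.
Qed.

Lemma near_ln_ge1 : \forall m \near \oo, (2 <= m)%N /\ 1 <= ln m%:R :> R.
Proof.
near=> m.
have m2 : (2 <= m)%N by near: m; exists 2.
split => //; rewrite -[leLHS]expRK ler_ln ?posrE ?expR_gt0//.
  by near: m; exact: nbhs_infty_ger.
by rewrite ltr0n; lia.
Unshelve. all: by end_near. Qed.

Lemma kl_rate_ge0 gamma b m : 0 < gamma -> 0 <= b -> 0 <= kl_rate gamma b m.
Proof.
by move=> g0 b0; rewrite addr_ge0// mulr_ge0// ?ln_ge0 ?divr_ge0; lra.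
Qed.

Lemma kl_rate_le gamma b : 0 < gamma -> gamma <= 1 / 2 -> 0 <= b ->
  exists2 K : R, 0 < K & forall m, (2 <= m)%N -> 1 <= ln m%:R :> R ->
    kl_rate gamma b m <= K * ln m%:R.
Proof.
move=> g0 g12 b0; have k0 := rate_gt0 _ g0 g12.
have l2 : 0 <= ln 2 :> R by rewrite ln_ge0// ler1n.
pose a := ln 2 + (b + 1) / gamma.
have bg : 0 <= (b + 1) / gamma by rewrite divr_ge0//; lra.
have a0 : 0 <= a by rewrite addr_ge0.
have i0 : 0 <= (rate gamma)^-1 by rewrite invr_ge0 ltW.
(* [kl_rate] is [a] times the number of rounds plus [ln 2], and the rounds are at most 2 / rate + 1
   times ln m; the last 1 makes the constant positive. *)
exists (a * (2 * (rate gamma)^-1 + 1) + ln 2 + 1).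
  have : 0 <= a * (2 * (rate gamma)^-1 + 1) by rewrite mulr_ge0//; lra.
  by lra.
move=> m m2 lm.
have T : (rounds gamma m)%:R <= (2 * (rate gamma)^-1 + 1) * ln m%:R.
  rewrite /rounds -natr1.
  have h : 0 <= ln m.+1%:R / rate gamma by rewrite mulr_ge0// ln_ge0// ler1n.
  rewrite [leRHS]mulrDl mul1r lerD//; apply: (@le_trans _ _ (ln m.+1%:R / rate gamma)).
    by rewrite truncn_le.
  by rewrite mulrAC ler_wpM2r// ln_succ_le.
have -> : kl_rate gamma b m = a * (rounds gamma m)%:R + ln 2.
  by rewrite /kl_rate /a -natr1; ring.
have /= := ler_wpM2l a0 T.
by move: (rounds gamma m)%:R => t; nra.
Qed.

Lemma loss_rateE gamma b m : (0 < m)%N ->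
  loss_rate gamma b m = (kl_rate gamma b m + ln m%:R + 1) / m%:R.
Proof.
move=> m0; have m0' : 0 < m%:R :> R by rewrite ltr0n.
rewrite /loss_rate -expRD divfK ?gt_eqF//.
rewrite (_ : _ - _ = - ln m%:R); last by ring.
by rewrite expRN lnK ?posrE// mulrDl div1r.
Qed.

Lemma loss_level_ge0 gamma b m : 0 < gamma -> 0 <= b -> 0 <= loss_level gamma b m.
Proof.
move=> g0 b0; case: m => [|m]; first by rewrite /loss_level invr0 mulr0.
by rewrite divr_ge0// addr_ge0 ?kl_rate_ge0// ln_ge0// ler1n.
Qed.

Lemma kl_rate_O gamma b : 0 < gamma -> gamma <= 1 / 2 -> 0 <= b ->
  kl_rate gamma b =O_\oo (fun m : nat => ln (m%:R : R)).
Proof.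
move=> g0 g12 b0; have [K K0 Kle] := kl_rate_le _ _ g0 g12 b0.
apply/eqO_exP; exists K => //; near=> m.
have [m2 lm] : (2 <= m)%N /\ 1 <= ln m%:R :> R by near: m; exact: near_ln_ge1.
rewrite !ger0_norm ?kl_rate_ge0//; last lra.
exact: Kle.
Unshelve. all: by end_near. Qed.

Lemma near_loss_rate_le gamma b : 0 < gamma -> gamma <= 1 / 2 -> 0 <= b ->
  exists2 K : R, 0 < K & \forall m \near \oo,
    0 <= loss_rate gamma b m <= K * (ln m%:R / m%:R).
Proof.
move=> g0 g12 b0; have [K K0 Kle] := kl_rate_le _ _ g0 g12 b0.
(* The summands [ln m] and 1 in the numerator of [loss_rateE] are each at most [ln m]. *)
exists (K + 2); first lra.
near=> m.
have [m2 lm] : (2 <= m)%N /\ 1 <= ln m%:R :> R by near: m; exact: near_ln_ge1.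
have k0 := kl_rate_ge0 gamma b m g0 b0.
rewrite loss_rateE; last lia.
rewrite divr_ge0//=; last by lra.
rewrite mulrA ler_wpM2r ?invr_ge0//.
by have := Kle _ m2 lm; lra.
Unshelve. all: by end_near. Qed.

(** The rate is in fact of order ln m / m, and x <= sqrt x for x in [0, 1]. *)
Lemma loss_rate_O gamma b : 0 < gamma -> gamma <= 1 / 2 -> 0 <= b ->
  loss_rate gamma b =O_\oo (fun m : nat => Num.sqrt (ln (m%:R : R) / m%:R)).
Proof.
move=> g0 g12 b0; have [K K0 Kle] := near_loss_rate_le _ _ g0 g12 b0.
apply/eqO_exP; exists K => //; near=> m.
have [m2 lm] : (2 <= m)%N /\ 1 <= ln m%:R :> R by near: m; exact: near_ln_ge1.
have /andP[l0 lK] : 0 <= loss_rate gamma b m <= K * (ln m%:R / m%:R) by near: m.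
have m0 : 0 < m%:R :> R by rewrite ltr0n; lia.
rewrite !ger0_norm ?sqrtr_ge0//; apply: (le_trans lK).
apply: ler_wpM2l; first exact: ltW.
have x0 : 0 <= ln m%:R / m%:R :> R by rewrite divr_ge0//; lra.
have x1 : ln m%:R / m%:R <= 1 :> R.
  by rewrite ler_pdivrMr// mul1r ltW// ln_sublinear.
have := sqr_sqrtr x0; have := sqrtr_ge0 (ln m%:R / m%:R : R).
have : Num.sqrt (ln m%:R / m%:R) <= 1 :> R by rewrite -[leRHS]sqrtr1 ler_sqrt.
by set y := Num.sqrt _ => y1 y0 y2; rewrite -y2 expr2 ler_piMl.
Unshelve. all: by end_near. Qed.

Lemma loss_rate_cvg0 gamma b : 0 < gamma -> gamma <= 1 / 2 -> 0 <= b ->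
  loss_rate gamma b @ \oo --> (0 : R).
Proof.
move=> g0 g12 b0; have [K K0 Kle] := near_loss_rate_le _ _ g0 g12 b0.
apply/cvgrPdist_lt => e e0; near=> m.
have [m2 lm] : (2 <= m)%N /\ 1 <= ln m%:R :> R by near: m; exact: near_ln_ge1.
have /andP[l0 lK] : 0 <= loss_rate gamma b m <= K * (ln m%:R / m%:R) by near: m.
have m0 : 0 < m%:R :> R by rewrite ltr0n; lia.
rewrite sub0r normrN ger0_norm//; apply: (le_lt_trans lK).
have y0 : 0 < Num.sqrt m%:R :> R by rewrite sqrtr_gt0.
have y2 : Num.sqrt m%:R ^+ 2 = m%:R :> R by rewrite sqr_sqrtr// ltW.
(* Writing m as the square of its root gives ln m = 2 ln (sqrt m), so the rate is at most 2 K / sqrt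
   m. *)
have ly : ln m%:R <= 2 * Num.sqrt m%:R :> R.
  by rewrite -{1}y2 lnXn// -[ln _ *+ _]mulr_natl ler_wpM2l// ltW// ln_sublinear.
have my : 2 * K / e < Num.sqrt m%:R.
  have : (2 * K / e) ^+ 2 < m%:R by near: m; exact: nbhs_infty_gtr.
  rewrite -{1}y2 => h; rewrite -(@ltr_pXn2r _ 2)// nnegrE ?divr_ge0 ?ltW//; nra.
rewrite mulrA ltr_pdivrMr// -[X in _ < _ * X]y2.
move: my; rewrite ltr_pdivrMr// => my.
apply: (@le_lt_trans _ _ (K * (2 * Num.sqrt m%:R))).
  by rewrite ler_wpM2l// ltW.
by rewrite expr2; nra.
Unshelve. all: by end_near. Qed.

End rates.

(** * The majority-vote prior and the conclusion *)

Lemma majority_prior {dX : measure_display} {X : measurableType dX} {R : realType}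
    {F : hypothesis_space X} (H : set (X -> bool)) (A : learning_rule R F)
    (k : nat) (P : probability F R) (gamma b : R) :
  0 < gamma -> 0 <= b -> gamma <= 1 / 2 ->
  measurable_fun setT (fun S : k.-tuple (X * bool)%type => KL (A S) P) ->
  (forall D, realizable H D -> (expected_loss D A k <= (1 / 2 - gamma)%:E)%E) ->
  (forall D, realizable H D -> (\int[iid D k]_S KL (A S) P <= b%:E)%E) ->
  exists M : probability F R, forall s, realizable_sample R H s ->
    ((expR (- kl_rate gamma b (size s)))%:E <= M (interpolants s))%E.
Proof.
move=> g0 b0 g12 mKL Aloss AKL.
(* Component [n] is the law of the majority of [n] draws from [P]; [point] only supplies the element
   from which the constants are built. A sample is served by the component indexed by its number of
   rounds. *)
have [M MQ] := countable_mixture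
  (fun n => distribution (iid P n) (majority (point : F) n)).
exists M => s rs; set T := rounds gamma (size s).
apply: le_trans (MQ T _).
have -> : expR (- kl_rate gamma b (size s)) =
    (2 ^+ T.+1)^-1 * expR (- ((b + 1) / gamma)) ^+ T.
  rewrite /kl_rate -/T opprD expRD; congr (_ * _).
    by rewrite expRN expRM_natl lnK ?posrE.
  by rewrite -mulrN expRM_natl.
rewrite EFinM lee_wpmul2l//.
apply: (majority_mass _ _ gamma) => //.
- exact: rounds_lt1.
- by move=> w w0; exact: (prior_mass_weak_sample H _ _ A k).
- exact: measurable_interpolants.
Qed.

Theorem theorem2p2 (R : realType) (gamma b : R)
    (gamma_gt0 : 0 < gamma) (b_ge0 : 0 <= b) :
  exists bstar epsstar : nat -> R,
    [/\ bstar =O_\oo (fun m : nat => ln (m%:R : R)),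
        epsstar =O_\oo (fun m : nat => Num.sqrt (ln (m%:R : R) / m%:R)) &
    forall (dX : measure_display) (X : measurableType dX)
      (F : hypothesis_space X) (H : set (X -> bool))
      (A : learning_rule R F) (k : nat) (P : probability F R),
    (forall h, H h -> measurable_fun [set: X] h) ->
    measurable_fun [set: k.-tuple (X * bool)%type]
      (fun S : k.-tuple (X * bool)%type => KL (A S) P) ->
    (forall D : probability (X * bool)%type R, realizable H D ->
       (expected_loss D A k <= (1 / 2 - gamma)%:E)%E) ->
    (forall D : probability (X * bool)%type R, realizable H D ->
       (\int[iid D k]_S KL (A S) P <= b%:E)%E) ->
    exists (Astar : learning_rule R F) (Pstar : probability F R),
      [/\ interpolating H Astar,
          PAC_learns H Astar &
          forall (D : probability (X * bool)%type R) (m : nat),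
            realizable H D ->
            {ae iid D m, forall S : m.-tuple (X * bool)%type,
                (KL (Astar S) Pstar <= (bstar m)%:E)%E} /\
            (expected_loss D Astar m <= (epsstar m)%:E)%E]].
Proof.
(* Lowering gamma weakens the loss assumption, and g <= 1/2 keeps 1 - g^2 / 2 strictly between 0 and
   1. *)
pose g := Num.min gamma (1 / 2).
have g0 : 0 < g by rewrite lt_min gamma_gt0/=; lra.
have g12 : g <= 1 / 2 by rewrite ge_min lexx orbT.
have gg : g <= gamma by rewrite ge_min lexx.
exists (kl_rate g b), (loss_rate g b); split.
- exact: kl_rate_O.
- exact: loss_rate_O.
move=> dX X F H A k P mH mKL Aloss AKL.
have Aloss' (D : probability (X * bool)%type R) : realizable H D ->
    (expected_loss D A k <= (1 / 2 - g)%:E)%E.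
  by move=> rD; rewrite (le_trans (Aloss D rD))// lee_fin; lra.
have [M MI] := majority_prior H A k P g b g0 b_ge0 g12 mKL Aloss' AKL.
have aeMI (D : probability (X * bool)%type R) m : realizable H D ->
  {ae iid D m, forall S : m.-tuple (X * bool)%type,
    ((expR (- kl_rate g b m))%:E <= M (interpolants S))%E}.
  move=> rD; have := ae_realizable_sample H D m mH rD.
  by apply: filterS => S rS; have := MI S rS; rewrite size_tuple.
have lossM (D : probability (X * bool)%type R) m : realizable H D ->
    (expected_loss D (posterior_rule M) m <= (loss_rate g b m)%:E)%E.
  (* Exposes the mass bound c = exp(- kl_rate), whose inverse is the factor in [loss_rate]. *)
  move=> rD; rewrite /loss_rate -[expR (kl_rate g b m)]invrK -expRN.
  apply: expected_loss_posterior_le; [exact: expR_gt0|exact: loss_level_ge0|].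
  exact: aeMI.
exists (posterior_rule M), M; split.
- apply: posterior_rule_interpolating => s /MI; apply: lt_le_trans.
  by rewrite lte_fin expR_gt0.
- exists (loss_rate g b); first exact: loss_rate_cvg0.
  by move=> D rD m; exact: lossM.
move=> D m rD; split; last exact: lossM.
have := aeMI D m rD; apply: filterS => S MS.
apply: le_trans (KL_posterior_le M S _ (expR_gt0 _) MS) _.
by rewrite expRK opprK.
Qed.
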